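(* Let $1\le m\le n$ and $d\ge 1$ be integers, $r>0$, let $f:B^n_r\to\mathbb{R}^m$ be a $C^d$-smooth mapping, and let $\Lambda=(\lambda_1,\dots,\lambda_m)$ with $\lambda_i\ge 0$, and $\lambda_0:=1$. Let $c=c(n,d)$ be the constant described in the context. Let $E=E(f,\Lambda)$ be the set of all $\varepsilon>0$ such that $$M(\varepsilon,\Delta(f,\Lambda))> c\sum_{i=0}^m\lambda_0\lambda_1\cdots\lambda_i\Big(\frac r\varepsilon\Big)^i .$$ For each $\varepsilon\in E$ let $\eta=\eta(\varepsilon)>1$ be the unique solution of the equation $$M(\varepsilon,\Delta(f,\Lambda)) = c\sum_{i=0}^m\lambda_0\lambda_1\cdots\lambda_i\Big(\frac r\varepsilon\Big)^i\eta^{\frac{n-i}{d}} .$$ Assume that $E$ is not empty and define $$\gamma=\gamma(f,\Lambda)=\sup_{\varepsilon\in E}\ \eta(\varepsilon)\,\varepsilon .$$ Then $R_d(f)\ge\gamma$.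
   Context: $B^n_r$ is the closed ball of radius $r$ in $\mathbb{R}^n$ centered at the origin, $B^n=B^n_1$. For a $C^d$-smooth mapping $f:B^n_r\to\mathbb{R}^m$ with $m\le n$ and $x\in B^n_r$, the image $df(x)(B^n)$ of the unit ball under the differential is a (possibly degenerate) ellipsoid in $\mathbb{R}^m$; its semi-axes are denoted $\lambda_1(x)\ge\lambda_2(x)\ge\dots\ge\lambda_m(x)\ge 0$. For $\Lambda=(\lambda_1,\dots,\lambda_m)$ the set of $\Lambda$-near-critical points is $\Sigma(f,\Lambda)=\{x\in B^n_r:\ \lambda_i(x)\le\lambda_i,\ i=1,\dots,m\}$, and the set of $\Lambda$-near-critical values is $\Delta(f,\Lambda)=f(\Sigma(f,\Lambda))$. The Taylor constant is $R_d(f)=\frac{\max_{x\in B^n_r}\|f^{(d)}(x)\|}{d!}\,r^d$, where $\|\cdot\|$ is the (Euclidean operator) norm of the $d$-th derivative. For a compact set $S$ in a metric space $Y$ and $\varepsilon>0$, the covering number $M(\varepsilon,S)$ is the minimal number of balls of radius $\varepsilon$ in $Y$ covering $S$. The constant $c=c(n,d)>0$ depends only on $n$ and $d$ and is a constant for which the following known theorem (Yomdin; Theorem 9.2 in the book of Yomdin and Comte) holds: for every $r>0$, $m\le n$, every $C^d$-smooth $f:B^n_r\to\mathbb{R}^m$, every $\Lambda=(\lambda_1,\dots,\lambda_m)$ with $\lambda_i\ge0$ (and $\lambda_0=1$) and every $\varepsilon>0$, $$M(\varepsilon,\Delta(f,\Lambda))\le c\sum_{i=0}^m\lambda_0\lambda_1\cdots\lambda_i\Big(\frac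 r\varepsilon\Big)^i\quad\text{if }\varepsilon\ge R_d(f),$$ $$M(\varepsilon,\Delta(f,\Lambda))\le c\sum_{i=0}^m\lambda_0\lambda_1\cdots\lambda_i\Big(\frac r\varepsilon\Big)^i\Big(\frac{R_d(f)}{\varepsilon}\Big)^{\frac{n-i}{d}}\quad\text{if }\varepsilon\le R_d(f).$$ Such a constant exists by that theorem and is fixed once and for all. *)

(* Defs.v *)
(* MathComp-Analysis over an abstract R : realType; R^n is 'rV[R]_n, and linear
   maps act on row vectors from the right. *)
From HB Require Import structures.
From mathcomp Require Import all_boot all_order all_algebra.
From mathcomp Require Import all_classical all_reals all_analysis.

Set Implicit Arguments.
Unset Strict Implicit.
Unset Printing Implicit Defensive.

Import Order.TTheory GRing.Theory Num.Theory numFieldNormedType.Exports.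
Local Open Scope classical_set_scope.
Local Open Scope ring_scope.

(* The norm `|x| of the library on row vectors is the sup norm. *)
Definition enorm (R : realType) (n : nat) (x : 'rV[R]_n) : R :=
  Num.sqrt (\sum_i x ord0 i ^+ 2).

Definition eball (R : realType) (n : nat) (a : 'rV[R]_n) (r : R) :
    set 'rV[R]_n :=
  [set x | enorm (x - a) <= r].

(* Frechet derivative relative to a subset B, so that it makes sense at the
   boundary points of a closed ball without extending the function. It
   does not depend on the choice of norms. *)
Definition is_diff_in (R : realType) (n p : nat) (B : set 'rV[R]_n)
    (g : 'rV[R]_n -> 'rV[R]_p) (x : 'rV[R]_n) (L : 'M[R]_(n, p)) : Prop :=
  forall e : R, 0 < e ->
    \forall y \near within B (nbhs x),
      enorm (g y - g x - (y - x) *m L) <= e * enorm (y - x).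

(* On a ball of positive radius the derivative is unique when it exists. *)
Definition diff_in (R : realType) (n p : nat) (B : set 'rV[R]_n)
    (g : 'rV[R]_n -> 'rV[R]_p) (x : 'rV[R]_n) : 'M[R]_(n, p) :=
  xget 0 [set L | is_diff_in B g x L].

(* nderiv B f [:: v1; ...; vk] x is the k-th derivative of f at x, a k-linear
   map, evaluated at (v1, ..., vk):
   f^(k)(x)(v1, ..., vk) = d(y |-> f^(k-1)(y)(v2, ..., vk))(x)(v1). *)
Fixpoint nderiv (R : realType) (n m : nat) (B : set 'rV[R]_n)
    (f : 'rV[R]_n -> 'rV[R]_m) (vs : seq 'rV[R]_n) : 'rV[R]_n -> 'rV[R]_m :=
  if vs is v :: vs' then fun x => v *m diff_in B (nderiv B f vs') x else f.

(* f is C^d on B. A map into the (finite-dimensional) space of k-linear maps is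
   differentiable, or continuous, iff all its evaluations are. *)
Definition smooth_on (R : realType) (n m d : nat) (B : set 'rV[R]_n)
    (f : 'rV[R]_n -> 'rV[R]_m) : Prop :=
  (forall vs : seq 'rV[R]_n, (size vs < d)%N -> forall x, B x ->
     exists L, is_diff_in B (nderiv B f vs) x L) /\
  (forall vs : seq 'rV[R]_n, (size vs <= d)%N ->
     {within B, continuous (nderiv B f vs)}).

Definition nderiv_norm (R : realType) (n m d : nat) (B : set 'rV[R]_n)
    (f : 'rV[R]_n -> 'rV[R]_m) (x : 'rV[R]_n) : R :=
  sup [set enorm (nderiv B f vs x) | vs in
        [set vs : d.-tuple 'rV[R]_n | forall i, enorm (tnth vs i) <= 1]].

Definition taylor_const (R : realType) (n m d : nat) (r : R)
    (f : 'rV[R]_n -> 'rV[R]_m) : R :=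
  sup [set nderiv_norm d (eball 0 r) f x | x in eball 0 r] / d`!%:R * r ^+ d.

(* l is the family of semi-axes of the possibly degenerate ellipsoid A centered
   at 0, in nonincreasing order: the rows of U are orthonormal axes of A. *)
Definition is_semi_axes (R : realType) (m : nat) (A : set 'rV[R]_m)
    (l : 'rV[R]_m) : Prop :=
  [/\ forall i, 0 <= l ord0 i,
      forall i j : 'I_m, (i <= j)%N -> l ord0 j <= l ord0 i
    & exists U : 'M[R]_m, U *m U^T = 1%:M /\
        A = [set t *m diag_mx l *m U | t in eball 0 1]].

Definition semi_axes (R : realType) (m : nat) (A : set 'rV[R]_m) : 'rV[R]_m :=
  xget 0 [set l | is_semi_axes A l].

Definition diff_axis (R : realType) (n m : nat) (r : R)
    (f : 'rV[R]_n -> 'rV[R]_m) (x : 'rV[R]_n) (i : 'I_m) : R :=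
  semi_axes [set v *m diff_in (eball 0 r) f x | v in eball 0 1] ord0 i.

(* Indices are shifted: Lam i, for i = 0, ..., m - 1, is lambda_(i+1). *)
Definition near_critical_points (R : realType) (n m : nat) (r : R)
    (f : 'rV[R]_n -> 'rV[R]_m) (Lam : 'I_m -> R) : set 'rV[R]_n :=
  [set x | eball 0 r x /\ forall i, diff_axis r f x i <= Lam i].

Definition near_critical_values (R : realType) (n m : nat) (r : R)
    (f : 'rV[R]_n -> 'rV[R]_m) (Lam : 'I_m -> R) : set 'rV[R]_m :=
  f @` near_critical_points r f Lam.

Definition coverable (R : realType) (m : nat) (eps : R) (S : set 'rV[R]_m)
    (N : nat) : Prop :=
  exists a : 'I_N -> 'rV[R]_m, S `<=` \bigcup_i eball (a i) eps.

(* Meaningful for bounded S and eps > 0, when some finite cover exists. *)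
Definition covering_number (R : realType) (m : nat) (eps : R)
    (S : set 'rV[R]_m) : nat :=
  xget 0%N [set N | coverable eps S N /\
                    forall N', coverable eps S N' -> (N <= N')%N].

(* lambda_0 lambda_1 ... lambda_i, with lambda_0 = 1. *)
Definition lam_prod (R : realType) (m : nat) (Lam : 'I_m -> R) (i : nat) : R :=
  \prod_(j < m | (j < i)%N) Lam j.

Definition entropy_sum (R : realType) (m : nat) (r : R) (Lam : 'I_m -> R)
    (eps : R) : R :=
  \sum_(i < m.+1) lam_prod Lam i * (r / eps) ^+ i.

Definition weighted_entropy_sum (R : realType) (n m d : nat) (r : R)
    (Lam : 'I_m -> R) (eps eta : R) : R :=
  \sum_(i < m.+1)
    lam_prod Lam i * (r / eps) ^+ i * eta `^ ((n - i)%:R / d%:R).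

Definition yomdin_constant (R : realType) (n d : nat) (c : R) : Prop :=
  forall (r : R) (m : nat) (f : 'rV[R]_n -> 'rV[R]_m) (Lam : 'I_m -> R)
    (eps : R),
    0 < r -> (1 <= m <= n)%N -> smooth_on d (eball 0 r) f ->
    (forall i, 0 <= Lam i) -> 0 < eps ->
    let M : R := (covering_number eps (near_critical_values r f Lam))%:R in
    (taylor_const d r f <= eps -> M <= c * entropy_sum r Lam eps) /\
    (eps <= taylor_const d r f ->
       M <= c * weighted_entropy_sum n d r Lam eps (taylor_const d r f / eps)).

Definition excess_set (R : realType) (n m : nat) (c r : R)
    (f : 'rV[R]_n -> 'rV[R]_m) (Lam : 'I_m -> R) : set R :=
  [set eps | 0 < eps /\
     (covering_number eps (near_critical_values r f Lam))%:R
       > c * entropy_sum r Lam eps].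

Definition is_eta (R : realType) (n m d : nat) (c r : R)
    (f : 'rV[R]_n -> 'rV[R]_m) (Lam : 'I_m -> R) (eps eta : R) : Prop :=
  1 < eta /\
  (covering_number eps (near_critical_values r f Lam))%:R
    = c * weighted_entropy_sum n d r Lam eps eta.

Definition eta_of (R : realType) (n m d : nat) (c r : R)
    (f : 'rV[R]_n -> 'rV[R]_m) (Lam : 'I_m -> R) (eps : R) : R :=
  xget 0 [set eta | is_eta d c r f Lam eps eta].

(* An extended real, so that a bound on it includes boundedness of the set. *)
Definition gamma_of (R : realType) (n m d : nat) (c r : R)
    (f : 'rV[R]_n -> 'rV[R]_m) (Lam : 'I_m -> R) : \bar R :=
  ereal_sup [set (eta_of d c r f Lam eps * eps)%:E
            | eps in excess_set c r f Lam].

(* Main.v *)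
Require Import Defs.
From mathcomp Require Import all_boot all_order all_algebra.
From mathcomp Require Import all_classical all_reals all_analysis.

Import Order.TTheory GRing.Theory Num.Theory numFieldNormedType.Exports.
Local Open Scope classical_set_scope.
Local Open Scope ring_scope.

(** Write W eta for [weighted_entropy_sum n d r Lam eps eta].  Its summands are
    nonnegative multiples of powers of eta with nonnegative exponents, and the
    summand of index 0 is eta to the power n / d > 0, with coefficient
    lambda_0 = 1.  Hence W is strictly increasing, and it grows from the
    unweighted sum at eta = 1 to infinity; being continuous, it takes every
    value above W 1 at exactly one point beyond 1.  For eps in the excess set,
    the covering number divided by c is such a value, so eta(eps) is well
    defined.

    For such an eps, the first half of Yomdin's theorem contradicts
    R_d(f) <= eps.  So eps < R_d(f), and the second half bounds
    c * W (eta(eps)), which is the covering number, by c * W (R_d(f) / eps).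
    By strict monotonicity eta(eps) <= R_d(f) / eps, that is,
    eta(eps) * eps <= R_d(f); the supremum over eps then gives the bound on
    gamma. *)

Section WeightedEntropySum.
Variables (R : realType) (n m d : nat) (r eps : R) (Lam : 'I_m -> R).
Hypotheses (n_gt0 : (0 < n)%N) (d_gt0 : (0 < d)%N).
Hypotheses (r_gt0 : 0 < r) (eps_gt0 : 0 < eps).
Hypothesis Lam_ge0 : forall i, 0 <= Lam i.

Local Notation W := (weighted_entropy_sum n d r Lam eps).

Lemma entropy_coef_ge0 i : 0 <= lam_prod Lam i * (r / eps) ^+ i.
Proof.
by rewrite mulr_ge0 ?prodr_ge0// exprn_ge0// divr_ge0 ?ltW.
Qed.

Lemma weighted_entropy_sum1 : W 1 = entropy_sum r Lam eps.
Proof. by apply: eq_bigr => i _; rewrite powR1 mulr1. Qed.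

Lemma leading_exponent_gt0 : 0 < n%:R / d%:R :> R.
Proof. by rewrite divr_gt0// ltr0n. Qed.

Lemma lam_prod0 : lam_prod Lam 0 = 1.
Proof. by rewrite /lam_prod big_pred0. Qed.

(** The summand of index 0 is the only one whose coefficient cannot vanish; it
    is split off because it alone gives strict growth and unboundedness. *)
Lemma weighted_entropy_sum_recl eta :
  W eta = eta `^ (n%:R / d%:R) +
    \sum_(i < m) lam_prod Lam i.+1 * (r / eps) ^+ i.+1
                 * eta `^ ((n - i.+1)%:R / d%:R).
Proof.
by rewrite /weighted_entropy_sum big_ord_recl/= lam_prod0 expr0 !mul1r subn0.
Qed.

Lemma weighted_entropy_sum_lt x y : 0 <= x -> x < y -> W x < W y.
Proof.
move=> x_ge0 xy; have y_ge0 : 0 <= y by rewrite (le_trans x_ge0)// ltW.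
rewrite !weighted_entropy_sum_recl ltr_leD//.
  by apply: gt0_ltr_powR => //; exact: leading_exponent_gt0.
apply: ler_sum => i _; rewrite ler_wpM2l ?entropy_coef_ge0//.
by apply: ge0_ler_powR => //; exact: ltW.
Qed.

Lemma powR_le_weighted_entropy_sum eta : eta `^ (n%:R / d%:R) <= W eta.
Proof.
rewrite weighted_entropy_sum_recl lerDl sumr_ge0// => i _.
by rewrite mulr_ge0 ?entropy_coef_ge0// powR_ge0.
Qed.

Lemma continuous_weighted_entropy_sum b : {within `[1, b], continuous W}.
Proof.
apply: derivable_within_continuous => x; rewrite in_itv/= => /andP[x_ge1 _].
have -> : W = \sum_(i < m.+1) (lam_prod Lam i * (r / eps) ^+ i) *:
    ((fun eta => eta `^ ((n - i)%:R / d%:R)) : R -> R).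
  by apply/funext => eta; rewrite fct_sumE.
apply: derivable_sum => i; apply: derivableZ; apply: derivable_powR.
by rewrite in_itv/= andbT (lt_le_trans ltr01).
Qed.

(** Existence is the intermediate value theorem, uniqueness is strict
    monotonicity; 1 is excluded as a solution because v exceeds W 1. *)
Lemma weighted_entropy_sum_solution v :
  W 1 < v -> exists! eta, 1 < eta /\ v = W eta.
Proof.
move=> W1v; have e_gt0 := leading_exponent_gt0.
have v_gt1 : 1 < v.
  apply: le_lt_trans W1v.
  by have := powR_le_weighted_entropy_sum 1; rewrite powR1.
(* At b the summand of index 0 already equals v, so b bounds the search. *)
pose b := v `^ (n%:R / d%:R)^-1.
have vWb : v <= W b.
  apply: le_trans (powR_le_weighted_entropy_sum b).
  by rewrite -powRrM mulVf ?gt_eqF// powRr1// ltW// (lt_trans ltr01).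
have b_ge1 : 1 <= b.
  rewrite -[leLHS](powRr0 v).
  by apply: ler_powR; [exact: ltW | rewrite invr_ge0 ltW].
have [|eta] := @IVT R W 1 b v b_ge1 (continuous_weighted_entropy_sum b).
  by rewrite ge_min le_max (ltW W1v) vWb orbT.
rewrite in_itv/= => /andP[eta_ge1 _] Weta; exists eta; split.
  split=> //; rewrite lt_neqAle eta_ge1 andbT; apply: contraTneq W1v => ->.
  by rewrite Weta ltxx.
move=> y [y_gt1 vWy]; have y_ge0 : 0 <= y by rewrite ltW// (lt_trans ltr01).
have eta_ge0 : 0 <= eta by rewrite (le_trans ler01).
have [/(weighted_entropy_sum_lt _ _ eta_ge0)|/(weighted_entropy_sum_lt _ _ y_ge0)|//]
  := ltgtP eta y; by rewrite Weta -vWy ltxx.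
Qed.

End WeightedEntropySum.

Theorem theorem3p2 (R : realType) (n m d : nat) (r c : R)
    (f : 'rV[R]_n -> 'rV[R]_m) (Lam : 'I_m -> R) :
  (1 <= m)%N -> (m <= n)%N -> (1 <= d)%N -> 0 < r ->
  smooth_on d (eball 0 r) f ->
  (forall i, 0 <= Lam i) ->
  0 < c -> yomdin_constant n d c ->
  excess_set c r f Lam !=set0 ->
  (forall eps, excess_set c r f Lam eps ->
     exists! eta, is_eta d c r f Lam eps eta) /\
  (gamma_of d c r f Lam <= (taylor_const d r f)%:E)%E.
Proof.
move=> m_gt0 mn d_gt0 r_gt0 fC Lam_ge0 c_gt0 yom _.
have n_gt0 : (0 < n)%N := leq_trans m_gt0 mn.
have eta_ex eps : excess_set c r f Lam eps ->
    exists! eta, is_eta d c r f Lam eps eta.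
  move=> [eps_gt0 exc].
  set M : R := (covering_number _ _)%:R in exc *.
  have W1v : weighted_entropy_sum n d r Lam eps 1 < M / c.
    by rewrite weighted_entropy_sum1 ltr_pdivlMr// mulrC.
  have eqM eta : (M / c = weighted_entropy_sum n d r Lam eps eta) <->
                 (M = c * weighted_entropy_sum n d r Lam eps eta).
    by split=> [<-|->]; rewrite mulrC ?divfK ?mulKf ?gt_eqF.
  have [eta [[eta_gt1 /eqM etaE] eta_uniq]] :=
    weighted_entropy_sum_solution _ _ _ _ _ _ _ n_gt0 d_gt0 r_gt0 eps_gt0 Lam_ge0 _ W1v.
  by exists eta; split=> // y [y_gt1 /eqM yE]; exact: eta_uniq.
split=> //; apply: ge_ereal_sup => _ [eps exc <-]; rewrite lee_fin.
have : is_eta d c r f Lam eps (eta_of d c r f Lam eps).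
  by apply: xgetPex; have [eta [etaP _]] := eta_ex eps exc; exists eta.
move: (eta_of _ _ _ _ _ _) => eta [eta_gt1 etaE].
case: exc => eps_gt0 exc.
have mn_range : (1 <= m <= n)%N by rewrite m_gt0.
have [le_eps ge_eps] := yom r m f Lam eps r_gt0 mn_range fC Lam_ge0 eps_gt0.
have [/le_eps|eps_lt] := leP (taylor_const d r f) eps.
  by rewrite leNgt exc.
have := ge_eps (ltW eps_lt); rewrite etaE ler_pM2l// => Wle.
rewrite -ler_pdivlMr// leNgt; apply: contraTN Wle => lt_eta; rewrite -ltNge.
apply: weighted_entropy_sum_lt => //.
by rewrite divr_ge0// ltW// (lt_trans eps_gt0).
Qed.
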